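(* Let $n = m^2$ and regard $S_m \wr S_2$ as a subgroup of $S_n$ via its product action on $\{1,\ldots,m\}^2$ (the two copies of $S_m$ acting on the two coordinates and $S_2$ swapping the coordinates). Then, for any $\alpha > 0$, the proportion of elements of $S_n$ conjugate to an element of $S_m \wr S_2$ is $O(n^{-3/4+\alpha})$ as $m \to \infty$. *)

(* Defs.v *)
From HB Require Import structures.
From mathcomp Require Import all_boot all_order all_algebra all_fingroup.
From mathcomp Require Import all_classical all_reals all_analysis.

Set Implicit Arguments.
Unset Strict Implicit.
Unset Printing Implicit Defensive.

Import Order.TTheory GRing.Theory Num.Theory.
Import numFieldNormedType.Exports.

Section ProductAction.
Variable m : nat.
Local Open Scope group_scope.

Definition coord_fun (s t : 'S_m) (x : 'I_m * 'I_m) : 'I_m * 'I_m :=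
  (s x.1, t x.2).

Lemma coord_fun_inj s t : injective (coord_fun s t).
Proof. by move=> [a b] [c d] [/perm_inj-> /perm_inj->]. Qed.

Definition coord_perm (s t : 'S_m) : {perm 'I_m * 'I_m} :=
  perm (@coord_fun_inj s t).

Definition swap_fun (x : 'I_m * 'I_m) : 'I_m * 'I_m := (x.2, x.1).

Lemma swap_fun_inj : injective swap_fun.
Proof. by move=> [a b] [c d] [-> ->]. Qed.

Definition swap_perm : {perm 'I_m * 'I_m} := perm swap_fun_inj.

Lemma coord_permM s t s' t' :
  coord_perm s t * coord_perm s' t' = coord_perm (s * s') (t * t').
Proof. by apply/permP=> x; rewrite permM !permE /coord_fun /= !permM. Qed.

Lemma swap_coord_perm s t :
  swap_perm * coord_perm s t = coord_perm t s * swap_perm.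
Proof. by apply/permP=> x; rewrite !permM !permE. Qed.

Lemma swap_permK : swap_perm * swap_perm = 1.
Proof. by apply/permP=> -[a b]; rewrite permM !permE. Qed.

(* The image of S_m wr S_2 = (S_m x S_m) : S_2 under its product action:
   the permutations (x, y) |-> (s x, t y) and (x, y) |-> (t y, s x). *)
Definition wreath2_set : {set {perm 'I_m * 'I_m}} :=
  [set coord_perm u.1.1 u.1.2 * swap_perm ^+ (u.2 : bool)
     | u : ('S_m * 'S_m) * bool].

Lemma wreath2_group_set : group_set wreath2_set.
Proof.
apply/group_setP; split.
  apply/imsetP; exists ((1, 1), false) => //=; rewrite mulg1.
  by apply/permP=> -[a b]; rewrite !permE /coord_fun /= !perm1.
move=> _ _ /imsetP[[[s t] b] _ ->] /imsetP[[[s' t'] b'] _ ->] /=.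
apply/imsetP; case: b => /=; last first.
  by exists ((s * s', t * t'), b'); rewrite //= mulg1 mulgA coord_permM.
exists ((s * t', t * s'), ~~ b') => //=.
rewrite expg1 -mulgA (mulgA swap_perm) swap_coord_perm -(mulgA _ swap_perm).
rewrite (mulgA (coord_perm s t)) coord_permM.
by case: b' => //=; rewrite ?expg1 ?swap_permK ?mulg1.
Qed.

Canonical wreath2 : {group {perm 'I_m * 'I_m}} := Group wreath2_group_set.

Lemma wreath2_gen :
  wreath2 = <<[set coord_perm s 1 | s : 'S_m] :|: [set coord_perm 1 t | t : 'S_m]
              :|: [set swap_perm]>> :> {set _}.
Proof.
apply/eqP; rewrite finset.eqEsubset; apply/andP; split; last first.
  rewrite gen_subG !finset.subUset finset.sub1set -!andbA; apply/and3P; split.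
  - apply/fintype.subsetP=> _ /imsetP[s _ ->]; apply/imsetP.
    by exists ((s, 1), false); rewrite //= mulg1.
  - apply/fintype.subsetP=> _ /imsetP[t _ ->]; apply/imsetP.
    by exists ((1, t), false); rewrite //= mulg1.
  - apply/imsetP; exists ((1, 1), true) => //=; rewrite expg1.
    by apply/permP=> -[a b]; rewrite permM !permE /swap_fun /= !perm1.
apply/fintype.subsetP=> _ /imsetP[[[s t] b] _ ->] /=.
rewrite -[s]mulg1 -[t]mul1g -coord_permM !groupM ?groupX // mem_gen // !inE.
- by apply/orP; left; apply/orP; left; apply: imset_f.
- by apply/orP; left; apply/orP; right; apply: imset_f.
- by rewrite eqxx orbT.
Qed.

End ProductAction.

Definition conj_proportion (R : realType) (gT : finGroupType) (W : {group gT}) : R :=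
  (#|class_support W [set: gT]|%:R / #|[set: gT]|%:R)%R.

(* Main.v *)
(** A permutation of an [n]-set leaves at least [2 ^ k] subsets invariant if it
    has [k] cycles, and a random one leaves [n + 1] subsets invariant on average;
    so with [L] a suitable multiple of [log m] only a proportion [O(m ^ -2)] of
    the permutations has more than [L] cycles.  An element of the wreath product
    that swaps the coordinates has at least [m / 2] cycles.  For an element
    [(s, t)] of the base group with at most [L] cycles, a cycle of [s] of length
    [a] and a cycle of [t] of length [b] produce [gcd(a, b)] cycles of length
    [lcm(a, b)], so these gcds are at most [L] and the longest cycles of [s] and
    [t] have length at least [m / L].  Taking longest cycles [a], [b] and further
    cycles [a'], [b'], the permutation has distinct cycles of lengths
    [lcm(a, b)], [lcm(a, b')], [lcm(a', b)], which happens with probability at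
    most the product of the inverse lengths, hence at most
    [L ^ 7 / (m ^ 4 a' b')].  Summing over [a, b, a', b' <= m] gives
    [O(L ^ 9 / m ^ 2)]; the case where [s] or [t] is an [m]-cycle is similar,
    with two cycles.  So the proportion is in fact [n ^ (-1 + o(1))]. *)

Require Import Defs.
From mathcomp Require Import all_boot all_order all_algebra all_fingroup.
From mathcomp Require Import zify ring lra.

Set Implicit Arguments.
Unset Strict Implicit.
Unset Printing Implicit Defensive.

(** * Cycles of a permutation of a finite set *)

Section Cycles.
Local Open Scope group_scope.
Variable T : finType.
Implicit Types (s t g : {perm T}) (x y : T) (A B : {set T}).

Lemma card_setT_perm : #|[set: {perm T}]| = #|T|`!.
Proof.
rewrite -cardsT -card_Sym; apply: eq_card => s.
by rewrite !inE; apply/esym/subsetP=> x; rewrite inE.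
Qed.

(** Cycle lengths are identified below by the exponents they divide. *)
Lemma permX_fix_dvd s x k : ((s ^+ k) x == x) = (#|porbit s x| %| k).
Proof.
set c := #|porbit s x|.
have c_gt0 : 0 < c by rewrite lt0n card_porbit_neq0.
have sc : (s ^+ c) x = x by rewrite permX iter_porbit.
have scj j : (s ^+ (j * c)) x = x.
  by elim: j => [|j IHj]; rewrite ?perm1 // mulSn expgD permM sc.
rewrite {1}(divn_eq k c) expgD permM scj /dvdn.
apply/eqP/eqP => [sk|->]; last by rewrite perm1.
apply/eqP; have U := uniq_traject_porbit s x; rewrite -/c in U.
have := @nth_uniq _ x _ (k %% c) 0 _ _ U; rewrite size_traject ltn_mod => <- //.
by rewrite !nth_traject ?ltn_mod // -permX sk.
Qed.

Lemma card_porbit_le s x k : 0 < k -> (s ^+ k) x = x -> #|porbit s x| <= k.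
Proof. by move=> k_gt0 /eqP; rewrite permX_fix_dvd => /dvdn_leq; apply. Qed.

Lemma porbit_conj s g x : porbit (s ^ g) (g x) = g @: porbit s x.
Proof.
apply/setP=> y; apply/porbitP/imsetP => [[i ->]|[_ /porbitP[i ->] ->]].
  by exists ((s ^+ i) x); rewrite ?mem_porbit // -conjXg !permM permK.
by exists i; rewrite -conjXg !permM permK.
Qed.

Lemma card_porbits_conj s g : #|porbits (s ^ g)| = #|porbits s|.
Proof.
have -> : porbits (s ^ g) = [set g @: A | A : {set T} in porbits s].
  apply/setP=> B; apply/imsetP/imsetP => [[y _ ->]|[_ /imsetP[x _ ->] ->]].
    by exists (porbit s (g^-1 y)); rewrite ?imset_f // -porbit_conj permKV.
  by exists (g x); rewrite // porbit_conj.
by rewrite card_imset //; apply: imset_inj; apply: perm_inj.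
Qed.

(** The cycles through points of [D] cover [D]. Read backwards, a large set lying on short cycles
    forces many cycles. *)
Lemma card_le_porbits s (D : {set T}) r :
  (forall x, x \in D -> #|porbit s x| <= r) -> #|D| <= r * #|porbits s|.
Proof.
move=> Dr; pose P := [set porbit s x | x in D].
have DP : D \subset cover P.
  by apply/subsetP=> x Dx; apply/bigcupP; exists (porbit s x);
    rewrite ?imset_f ?porbit_id.
apply: leq_trans (subset_leq_card DP) _; apply: leq_trans (leq_card_cover P) _.
apply: (@leq_trans (\sum_(A in P) r)).
  by apply: leq_sum => _ /imsetP[x Dx ->]; apply: Dr.
rewrite sum_nat_const mulnC leq_mul2l subset_leq_card ?orbT //.
by apply/subsetP=> _ /imsetP[x _ ->]; apply: imset_f.
Qed.

(** * Invariant subsets and permutations with many cycles *)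

Definition invariant_set s A := s @: A == A.

(** Such an [s] is the product of its restrictions to [A] and [~: A], each extended by the identity
    ([cut] below), so it lies in [Sym A * Sym (~: A)]. *)
Lemma card_invariant_perm A :
  #|[set s | invariant_set s A]| <= #|A|`! * #|~: A|`!.
Proof.
rewrite -card_Sym -(card_Sym (~: A)).
pose cut B s x := if x \in B then s x else x.
have cut_inj B s : s @: B = B -> injective (cut B s).
  move=> sB; have memB x : (s x \in B) = (x \in B).
    by rewrite -{1}sB mem_imset //; apply: perm_inj.
  move=> x y; rewrite /cut; have [Bx|nBx] := boolP (x \in B);
    have [By|nBy] := boolP (y \in B) => //.
  - exact: perm_inj.
  - by move=> E; rewrite -E memB Bx in nBy.
  - by move=> E; rewrite E memB By in nBx.
have invC s : s @: A = A -> s @: (~: A) = ~: A.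
  move=> sA; apply/setP=> x; rewrite -[x](permKV s) mem_imset; last exact: perm_inj.
  by rewrite !inE -{2}sA mem_imset //; apply: perm_inj.
apply: (@leq_trans #|Sym A * Sym (~: A)|); last first.
  by rewrite mul_cardG leq_pmulr ?cardG_gt0.
apply/subset_leq_card/subsetP=> s; rewrite inE => /eqP sA.
have sC := invC s sA.
apply/mulsgP; exists (perm (cut_inj A s sA)) (perm (cut_inj (~: A) s sC)).
1,2: rewrite inE; apply/subsetP=> x; rewrite inE permE /cut.
1,2: by case: ifP => //; rewrite eqxx.
apply/permP=> x; rewrite permM !permE /cut !inE.
have memA : (s x \in A) = (x \in A) by rewrite -{1}sA mem_imset //; apply: perm_inj.
by case Ax: (x \in A); rewrite ?memA Ax.
Qed.

(** Unions of cycles are invariant, and cycles being disjoint, distinct families of cycles have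
    distinct unions. *)
Lemma exp2_porbits_le s : 2 ^ #|porbits s| <= #|[set A | invariant_set s A]|.
Proof.
rewrite -card_powerset -(card_in_imset (f := @cover T)) /=.
  apply/subset_leq_card/subsetP=> _ /imsetP[P sP ->]; rewrite inE.
  rewrite powersetE in sP.
  rewrite /invariant_set eqEcard (card_imset _ (@perm_inj _ s)) leqnn andbT.
  apply/subsetP=> _ /imsetP[x /bigcupP[B PB Bx] ->]; apply/bigcupP; exists B => //.
  have /imsetP[z _ EB] := subsetP sP _ PB; rewrite EB in Bx *.
  by rewrite -eq_porbit_mem -[s x]/((s ^+ 1) x) porbit_perm eq_porbit_mem.
have mem_coverE (P : {set {set T}}) x :
    P \subset porbits s -> (x \in cover P) = (porbit s x \in P).
  move=> sP; apply/bigcupP/idP => [[B PB Bx]|Px]; last first.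
    by exists (porbit s x) => //; apply: porbit_id.
  have /imsetP[z _ EB] := subsetP sP _ PB; rewrite EB -eq_porbit_mem in Bx.
  by rewrite (eqP Bx) -EB.
move=> P Q; rewrite !powersetE => sP sQ PQ; apply/setP=> B.
have [/imsetP[x _ ->]|nB] := boolP (B \in porbits s);
  first by rewrite -!mem_coverE // PQ.
by rewrite (contraNF (subsetP sP B) nB) (contraNF (subsetP sQ B) nB).
Qed.

(** Double counting of the pairs of a permutation and a subset invariant under it. *)
Lemma card_many_porbits k :
  #|[set s : {perm T} | k <= #|porbits s| ]| * 2 ^ k <= #|T|.+1 * #|T|`!.
Proof.
rewrite -sum_nat_const.
apply: (@leq_trans (\sum_(s : {perm T}) #|[set A | invariant_set s A]|)).
  rewrite big_mkcond; apply: leq_sum => s _; rewrite inE; case: ifP => // ks.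
  apply: leq_trans (exp2_porbits_le s).
  by rewrite leq_exp2l.
under eq_bigr do rewrite -sum1dep_card.
rewrite (exchange_big_dep predT) //=.
under eq_bigr do rewrite sum1dep_card.
apply: (@leq_trans (\sum_(A : {set T}) #|A|`! * #|~: A|`!)).
  by apply: leq_sum => A _; apply: card_invariant_perm.
(* For each of the [#|T|.+1] sizes [k'], the binomial number of subsets times [k'! (#|T| - k')!] is
   [#|T|!]. *)
rewrite (partition_big (fun A : {set T} => inord #|A| : 'I_#|T|.+1) predT) //=.
rewrite -[X in _ <= X * _]card_ord -sum_nat_const; apply: leq_sum => k' _.
rewrite (eq_bigr (fun=> k'`! * (#|T| - k')`!)%N) => [|A /eqP <-]; last first.
  by rewrite inordK ?ltnS ?max_card // (cardsCs (~: A)) setCK.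
rewrite (eq_bigl [pred A : {set T} | #|A| == k']) => [|A]; last first.
  by rewrite -val_eqE /= inordK ?ltnS ?max_card.
rewrite sum_nat_cond_const (eq_card (B := [set A : {set T} | #|A| == k'])) => [|A].
  by rewrite card_draws bin_fact // -ltnS.
by rewrite !inE.
Qed.

(** * Permutations with distinct cycles of prescribed lengths *)

Definition cycles_at (I : finType) (r : I -> nat) s (x : {ffun I -> T}) :=
  [forall i, #|porbit s (x i)| == r i] && injectiveb (fun i => porbit s (x i)).

Section CycleWords.
Variables (I : finType) (r : I -> nat).

Let D := {i : I & 'I_(r i)}.

(** The selected cycles in cycle notation, each written from its marked point [x i]. *)
Definition cycle_word s (x : {ffun I -> T}) : {ffun D -> T} :=
  [ffun d : D => (s ^+ tagged d) (x (tag d))].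

Lemma cycle_word_inj s (x : {ffun I -> T}) :
  cycles_at r s x -> injectiveb (cycle_word s x).
Proof.
case/andP=> /forallP rx /injectiveP xI; apply/injectiveP=> -[i k] [j l].
rewrite !ffunE /= => E.
have Eij : i = j by apply: xI; rewrite -(porbit_perm s k) E porbit_perm.
case: _ / Eij l E => l E; congr Tagged; apply/val_inj/eqP => /=.
have U := uniq_traject_porbit s (x i); rewrite (eqP (rx i)) in U.
rewrite -(nth_uniq (x i) _ _ U) ?size_traject //.
by rewrite !nth_traject // -!permX E.
Qed.

(* Both cycles through [x i] close up after [r i] steps, so the word determines
   the permutation on all its letters, not merely on all but the last ones. *)
Lemma cycle_word_eq s t (x y : {ffun I -> T}) :
  cycles_at r s x -> cycles_at r t y -> cycle_word s x = cycle_word t y ->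
  x = y /\ forall d, s (cycle_word s x d) = t (cycle_word s x d).
Proof.
case/andP=> /forallP rx _ /andP[/forallP ry _] E.
have r_gt0 i : 0 < r i by rewrite -(eqP (rx i)) lt0n card_porbit_neq0.
have Ed (d : D) : (s ^+ tagged d) (x (tag d)) = (t ^+ tagged d) (y (tag d)).
  by have /ffunP/(_ d) := E; rewrite !ffunE.
have Exy : x = y.
  apply/ffunP=> i; have := Ed (Tagged (fun i => 'I_(r i)) (Ordinal (r_gt0 i))).
  by rewrite /= !perm1.
split=> // d; rewrite {2}E !ffunE -!permM -!expgSr -Exy.
have := ltn_ord (tagged d); rewrite leq_eqVlt => /predU1P[->|lt_r].
  by rewrite -{1}(eqP (rx _)) -(eqP (ry _)) -Exy !permX iter_porbit Exy iter_porbit.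
by have := Ed (Tagged (fun i => 'I_(r i)) (Ordinal lt_r)); rewrite /= -Exy.
Qed.

(** Permutations with the same word agree on its letters, so modulo one of them they fix these
    letters: at most [(#|T| - #|D|)!] pairs share a word. Multiplying by the number of injective
    words gives [#|T|!]. *)
Lemma card_cycles_at :
  #|[set p : {perm T} * {ffun I -> T} | cycles_at r p.1 p.2]| <= #|T|`!.
Proof.
have fiber (g : {ffun D -> T}) : injectiveb g ->
  #|[set p : {perm T} * {ffun I -> T} |
     cycles_at r p.1 p.2 & cycle_word p.1 p.2 == g]| <= (#|T| - #|{: D}|)`!.
  move=> /injectiveP gI.
  set F := [set p | _].
  have [->|[[s0 x0] Fp0]] := set_0Vmem F; first by rewrite cards0.
  have [/= c0 /eqP g0] : cycles_at r s0 x0 /\ cycle_word s0 x0 == g.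
    by move: Fp0; rewrite inE => /andP.
  pose f (p : {perm T} * {ffun I -> T}) := p.1 * s0^-1.
  have Fword p : p \in F -> p.2 = x0 /\ forall d, p.1 (g d) = s0 (g d).
    rewrite inE => /andP[cp /eqP gp].
    by have := cycle_word_eq cp c0; rewrite gp g0 => /(_ erefl).
  rewrite -(card_in_imset (f := f)); last first.
    move=> [s x] [t y] /Fword[/= -> _] /Fword[/= -> _].
    by rewrite /f /= => /mulIg ->.
  have -> : #|T| - #|{: D}| = #|~: (g @: [set: D])|.
    by rewrite cardsCs setCK card_imset // cardsT.
  rewrite -card_Sym; apply/subset_leq_card/subsetP=> _ /imsetP[p /Fword[_ pg] ->].
  rewrite inE; apply/subsetP=> z; rewrite !inE; apply: contraNN => /imsetP[d _ ->].
  by rewrite permM pg permK.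
rewrite -sum1_card.
rewrite (partition_big (fun p => cycle_word p.1 p.2)
          (fun g : {ffun D -> T} => injectiveb g)) /=;
  last by move=> p; rewrite inE => /cycle_word_inj.
apply: (@leq_trans (\sum_(g : {ffun D -> T} | injectiveb g) (#|T| - #|{: D}|)`!)).
  apply: leq_sum => g gI; rewrite sum1dep_card; apply: leq_trans (fiber g gI).
  by apply/subset_leq_card/subsetP=> p; rewrite !inE.
rewrite sum_nat_cond_const.
rewrite (eq_card (B := [set g : {ffun D -> T} | injectiveb g])) => [|g].
  (* If the lengths add up to more than [#|T|], the subtraction truncates, but then no word is
     injective. *)
  rewrite card_inj_ffuns; have [lDT|lTD] := leqP #|{: D}| #|T|.
    by rewrite ffact_fact.
  by rewrite ffact_small.
by rewrite !inE.
Qed.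

End CycleWords.

Definition has_cycles (rs : seq nat) s :=
  [exists x, cycles_at (fun i : 'I_(size rs) => nth 0 rs i) s x].

Lemma has_cycles_map s (xs : seq T) :
  uniq (map (porbit s) xs) -> has_cycles [seq #|porbit s x| | x <- xs] s.
Proof.
(* [nth] needs a default point. If [xs] is empty, [T] may be empty too, and the marking is the empty
   function. *)
move=> U; suff gen (x0 : T) : has_cycles [seq #|porbit s x| | x <- xs] s.
  case: xs gen {U} => [_|x0 xs /(_ x0) //]; apply/existsP.
  exists [ffun i : 'I_0 => let: Ordinal _ i_lt0 := i in match notF i_lt0 with end].
  by apply/andP; split; [apply/forallP=> -[]|apply/injectiveP=> -[]].
apply/existsP; exists [ffun i => nth x0 xs (val i)].
have lt (i : 'I_(size [seq #|porbit s x| | x <- xs])) : i < size xs.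
  by rewrite -(size_map (fun x => #|porbit s x|)).
apply/andP; split; first by apply/forallP=> i; rewrite ffunE (nth_map x0) ?lt.
apply/injectiveP=> i j; rewrite !ffunE => E; apply/val_inj/eqP => /=.
by rewrite -(nth_uniq set0 _ _ U) ?(size_map (porbit s)) ?lt // !(nth_map x0) ?lt // E.
Qed.

Lemma has_cycles_conj rs s g : has_cycles rs s -> has_cycles rs (s ^ g).
Proof.
case/existsP=> x /andP[/forallP rx /injectiveP xI]; apply/existsP.
exists [ffun i => g (x i)]; apply/andP; split.
  by apply/forallP=> i; rewrite ffunE porbit_conj card_imset //; apply: perm_inj.
apply/injectiveP=> i j; rewrite !ffunE !porbit_conj.
by move/(imset_inj (@perm_inj _ g))/xI.
Qed.

(** Each marked point can be moved freely along its cycle, so a permutation with these cycles has at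
    least as many markings as the product of the lengths. *)
Lemma card_has_cycles rs :
  #|[set s | has_cycles rs s]| * \prod_(r <- rs) r <= #|T|`!.
Proof.
apply: leq_trans (card_cycles_at (fun i : 'I_(size rs) => nth 0 rs i)).
rewrite -sum_nat_const -[leqRHS]sum1dep_card.
set r := fun i : 'I_(size rs) => nth 0 rs i.
have -> : (\sum_(p : {perm T} * {ffun 'I_(size rs) -> T} | cycles_at r p.1 p.2) 1
           = \sum_s \sum_(x | cycles_at r s x) 1)%N by rewrite pair_big_dep.
rewrite big_mkcond; apply: leq_sum => s _; rewrite inE; case: ifP => //.
case/existsP=> x0 /andP[/forallP rx /injectiveP xI]; rewrite sum1dep_card.
rewrite (big_nth 0) big_mkord.
have -> : (\prod_(i < size rs) nth 0 rs i)%N =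
          #|family (fun i => mem (porbit s (x0 i)))|.
  rewrite card_family foldrE big_map big_enum; apply: eq_bigr => i _.
  by rewrite -(eqP (rx i)).
apply/subset_leq_card/subsetP=> x /familyP fx; rewrite inE.
have Ex i : porbit s (x i) = porbit s (x0 i).
  by apply/eqP; rewrite eq_porbit_mem; apply: fx.
apply/andP; split; first by apply/forallP=> i; rewrite Ex.
by apply/injectiveP=> i j; rewrite !Ex => /xI.
Qed.

End Cycles.

Section InversePorbitSum.
Import GRing.Theory Num.Theory.
Local Open Scope ring_scope.

Lemma sum_inv_card_porbit (T : finType) (s : {perm T}) :
  \sum_x (#|porbit s x|%:R^-1 : rat) = #|porbits s|%:R.
Proof.
rewrite (partition_big_imset (porbit s)) /= -/(porbits s) -sum1_card natr_sum.
apply: eq_bigr => _ /imsetP[x _ ->].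
rewrite (eq_bigr (fun=> #|porbit s x|%:R^-1)) => [|y /eqP-> //].
rewrite (eq_bigl (mem (porbit s x))) => [|y]; last by rewrite eq_porbit_mem.
by rewrite sumr_const -[LHS]mulr_natr mulVf // pnatr_eq0 card_porbit_neq0.
Qed.

End InversePorbitSum.

(** * Cycles of the elements of the wreath product *)

Section Wreath.
Local Open Scope group_scope.
Import GRing.Theory Num.Theory Order.TTheory.
Variable m : nat.
Implicit Types (s t : 'S_m) (z : 'I_m * 'I_m).

Lemma coord_permE s t z : coord_perm s t z = (s z.1, t z.2).
Proof. by rewrite permE. Qed.

Lemma swap_permE z : swap_perm m z = (z.2, z.1).
Proof. by rewrite permE. Qed.

Lemma coord_permX s t k : coord_perm s t ^+ k = coord_perm (s ^+ k) (t ^+ k).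
Proof.
elim: k => [|k IHk]; last by rewrite !expgS IHk coord_permM.
by apply/permP=> -[x y]; rewrite coord_permE !perm1.
Qed.

Lemma porbit_coord_perm s t z z' : z' \in porbit (coord_perm s t) z ->
  z'.1 \in porbit s z.1 /\ z'.2 \in porbit t z.2.
Proof.
by case/porbitP=> i ->; rewrite coord_permX coord_permE /= !mem_porbit.
Qed.

Lemma card_porbit_coord_perm s t z :
  #|porbit (coord_perm s t) z| = lcmn #|porbit s z.1| #|porbit t z.2|.
Proof.
have dvdE k : (#|porbit (coord_perm s t) z| %| k)
            = (lcmn #|porbit s z.1| #|porbit t z.2| %| k).
  by rewrite dvdn_lcm -!permX_fix_dvd coord_permX coord_permE; case: z.
by apply/eqP; rewrite eqn_dvd dvdE dvdnn -dvdE dvdnn.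
Qed.

(** The square of the swapping element acts by [s * t] on the first coordinate and by its conjugate
    [t * s = (s * t) ^ s] on the second, so [s y] returns when [y] does. *)
Lemma swap_coord_fixed s t x y : y \in porbit (s * t) x ->
  ((coord_perm s t * swap_perm m) ^+ (2 * #|porbit (s * t) x|)) (x, s y) = (x, s y).
Proof.
move=> xy; rewrite expgM; set w := coord_perm s t * _.
have -> : w ^+ 2 = coord_perm (s * t) (t * s).
  apply/permP=> z; rewrite expgS expg1 /w !permM !(coord_permE, swap_permE) /=.
  by rewrite !permM.
have ux (v : 'I_m) : v \in porbit (s * t) x -> ((s * t) ^+ #|porbit (s * t) x|) v = v.
  rewrite -eq_porbit_mem => /eqP vE.
  by apply/eqP; rewrite permX_fix_dvd vE.
rewrite coord_permX coord_permE /= ux ?porbit_id //.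
have -> : t * s = (s * t) ^ s by rewrite conjgE -!mulgA mulKg.
by rewrite -conjXg !permM permK ux.
Qed.


(* Each block [C x s C], for [C] a cycle of [s * t], splits into cycles of
   length at most [2 |C|], hence into at least [|C| / 2] of them. *)
Lemma swap_coord_porbits s t : m <= 2 * #|porbits (coord_perm s t * swap_perm m)|.
Proof.
set w := coord_perm s t * _; set u := s * t.
rewrite -(ler_nat rat) natrM -sum_inv_card_porbit.
have -> : (m%:R = 2%:R * \sum_(x : 'I_m) (2%:R^-1 : rat))%R.
  by rewrite sumr_const card_ord -[(_^-1 *+ m)%R]mulr_natr mulrA divff ?mul1r.
rewrite ler_pM2l //.
rewrite [leRHS](_ : _ = \sum_(x : 'I_m) \sum_(y : 'I_m)
    (#|porbit w (x, s y)|%:R^-1 : rat))%R; last first.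
  rewrite pair_big /= [RHS](reindex (fun z : 'I_m * 'I_m => (z.1, s^-1 z.2))) /=.
    by apply: eq_bigr => -[x y] _ /=; rewrite permKV.
  by exists (fun z => (z.1, s z.2)) => -[x y] _ /=; rewrite ?permK ?permKV.
apply: ler_sum => x _.
have c_gt0 : 0 < #|porbit u x| by rewrite lt0n card_porbit_neq0.
(* Only the [y] on the cycle of [x] are kept; their terms already add up to at least [1 / 2]. *)
apply: (@le_trans _ _ (\sum_(y in porbit u x) ((2 * #|porbit u x|)%:R^-1 : rat))%R).
  rewrite sumr_const -[(_^-1 *+ #|_|)%R]mulr_natr natrM invfM -mulrA mulVf ?mulr1 //.
  by rewrite pnatr_eq0 -lt0n.
rewrite big_mkcond /=; apply: ler_sum => y _; case: ifP => xy; last first.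
  by rewrite invr_ge0 ler0n.
rewrite lef_pV2 ?posrE ?ltr0n ?muln_gt0 ?c_gt0 //;
  last by rewrite lt0n card_porbit_neq0.
by rewrite ler_nat card_porbit_le ?muln_gt0 ?c_gt0 // swap_coord_fixed.
Qed.

Lemma card_porbits_coord_permC s t :
  #|porbits (coord_perm s t)| = #|porbits (coord_perm t s)|.
Proof.
rewrite -(card_porbits_conj (coord_perm t s) (swap_perm m)) conjgE.
by rewrite -swap_coord_perm mulKg.
Qed.

(** Let [a] be the largest cycle length of [s] and [b] that of the cycle of [y0]. The [m * b] points
    over this cycle lie on cycles of length at most [a * b], so [m * b <= a * b * L]. *)
Lemma coord_perm_large_cycle s t L x (y0 : 'I_m) :
    #|porbits (coord_perm s t)| <= L ->
    (forall x', #|porbit s x'| <= #|porbit s x|) ->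
  m <= #|porbit s x| * L.
Proof.
move=> leL maxx; set b := #|porbit t y0|.
have b_gt0 : 0 < b by rewrite lt0n card_porbit_neq0.
have := @card_le_porbits _ (coord_perm s t) (setX setT (porbit t y0))
                         (#|porbit s x| * b).
rewrite cardsX cardsT card_ord -/b mulnAC leq_pmul2r // => le.
apply: leq_trans (le _) _; last by rewrite leq_pmul2l // lt0n card_porbit_neq0.
move=> [x' y']; rewrite inE /= inE => /= y'y; rewrite card_porbit_coord_perm /=.
have -> : #|porbit t y'| = b by rewrite -eq_porbit_mem in y'y; rewrite (eqP y'y).
apply: leq_trans (leq_mul (maxx x') (leqnn b)).
apply: dvdn_leq; last by rewrite dvdn_lcm dvdn_mulr ?dvdn_mull.
by rewrite muln_gt0 b_gt0 andbT lt0n card_porbit_neq0.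
Qed.

(** All points of the product of the two cycles lie on cycles whose length is the lcm. This is the
    bound [gcd <= L] without division. *)
Lemma coord_perm_lcm_large s t L x y :
  #|porbits (coord_perm s t)| <= L ->
  #|porbit s x| * #|porbit t y| <= lcmn #|porbit s x| #|porbit t y| * L.
Proof.
move=> leL; rewrite -cardsX.
apply: (@leq_trans (lcmn #|porbit s x| #|porbit t y| * #|porbits (coord_perm s t)|)).
  apply: card_le_porbits => -[x' y'].
  rewrite inE /= -!eq_porbit_mem => /andP[/eqP xE /eqP yE].
  by rewrite card_porbit_coord_perm /= xE yE.
by rewrite leq_mul2l leL orbT.
Qed.

(* [a], [b] are the lengths of longest cycles of [s], [t], and [L] bounds the
   number of cycles of [(s, t)]; in [good_pair] one of [s], [t] is an [m]-cycle. *)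
Definition good_triple L a b a' b' :=
  [&& 0 < a', 0 < b', m <= a * L, m <= b * L, a * b <= lcmn a b * L,
      a * b' <= lcmn a b' * L & a' * b <= lcmn a' b * L].

Definition good_pair L b b' :=
  [&& 0 < b', m <= b * L, m * b <= lcmn m b * L & m * b' <= lcmn m b' * L].

Lemma coord_perm_cycles s t L : L < m -> #|porbits (coord_perm s t)| <= L ->
  (exists a b a' b' : 'I_m.+1, good_triple L a b a' b' /\
     has_cycles [:: lcmn a b; lcmn a b'; lcmn a' b] (coord_perm s t)) \/
  (exists b b' : 'I_m.+1, good_pair L b b' /\
     has_cycles [:: lcmn m b; lcmn m b'] (coord_perm s t)).
Proof.
move=> ltLm leL; have m_gt0 : 0 < m by apply: leq_ltn_trans ltLm.
pose i0 := Ordinal m_gt0; set w := coord_perm s t.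
have cgt0 (u : 'S_m) x : 0 < #|porbit u x| by rewrite lt0n card_porbit_neq0.
have cle (u : 'S_m) x : #|porbit u x| < m.+1.
  by rewrite ltnS -[X in _ <= X]card_ord max_card.
have [x1 _ x1max] := @arg_maxnP _ i0 predT (fun x => #|porbit s x|) isT.
have [y1 _ y1max] := @arg_maxnP _ i0 predT (fun x => #|porbit t x|) isT.
have ma : m <= #|porbit s x1| * L.
  by apply: coord_perm_large_cycle i0 leL _ => x'; apply: x1max.
have mb : m <= #|porbit t y1| * L.
  apply: (@coord_perm_large_cycle t s _ _ i0) => [|y]; last exact: y1max.
  by rewrite card_porbits_coord_permC.
have lcmL x y := @coord_perm_lcm_large s t L x y leL.
(* Decides whether a second cycle is available or the longest one is an [m]-cycle. *)
have full (u : 'S_m) x : (exists y, y \notin porbit u x) \/ #|porbit u x| = m.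
  have [/pred0P fullx|/pred0Pn[y]] := boolP (pred0b [predC porbit u x]);
    last by left; exists y.
  by right; rewrite -[RHS]card_ord; apply: eq_card => y; have /negbFE := fullx y.
pose o (u : 'S_m) x : 'I_m.+1 := Ordinal (cle u x).
have notin_neq x y x' y' : (x \notin porbit s x') || (y \notin porbit t y') ->
    porbit w (x, y) != porbit w (x', y').
  by rewrite eq_porbit_mem; apply: contraL => /porbit_coord_perm[/= -> ->].
have [[x2 nx2]|full_s] := full s x1; have [[y2 ny2]|full_t] := full t y1.
- left; exists (o s x1), (o t y1), (o s x2), (o t y2); split.
    by rewrite /good_triple /= !cgt0 ma mb !lcmL.
  have := @has_cycles_map _ w [:: (x1, y1); (x1, y2); (x2, y1)].
  rewrite /= !card_porbit_coord_perm; apply; rewrite !inE !negb_or.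
  by rewrite ![porbit w (x1, y1) == _]eq_sym !notin_neq ?ny2 ?nx2 ?orbT.
- right; exists (o s x1), (o s x2); split.
    have lcmLm x : m * #|porbit s x| <= lcmn m #|porbit s x| * L.
      by have := lcmL x y1; rewrite full_t mulnC lcmnC.
    by rewrite /good_pair /= cgt0 ma !lcmLm.
  have := @has_cycles_map _ w [:: (x1, y1); (x2, y1)].
  rewrite /= !card_porbit_coord_perm /= full_t ![lcmn _ m]lcmnC; apply.
  by rewrite !inE andbT eq_sym notin_neq ?nx2.
- right; exists (o t y1), (o t y2); split.
    have lcmLm y : m * #|porbit t y| <= lcmn m #|porbit t y| * L.
      by have := lcmL x1 y; rewrite full_s.
    by rewrite /good_pair /= cgt0 mb !lcmLm.
  have := @has_cycles_map _ w [:: (x1, y1); (x1, y2)].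
  rewrite /= !card_porbit_coord_perm /= full_s; apply.
  by rewrite !inE andbT eq_sym notin_neq ?ny2 ?orbT.
(* Two [m]-cycles have gcd [m], which would give [m <= L]. *)
have := lcmL x1 y1; rewrite full_s full_t /lcmn gcdnn mulnK // leq_pmul2l //.
by rewrite leqNgt ltLm.
Qed.

End Wreath.

(** * Numerical bounds and the union bound *)

Section Estimates.
Import GRing.Theory Num.Theory Order.TTheory.
Local Open Scope nat_scope.

(* The exponent 18 makes [L ^ 9] at most of order [m ^ (1 / 2)], which is the
   factor lost between [m ^ -2] and [n ^ (- 3 / 4) = m ^ (- 3 / 2)]. *)
Lemma log_power_bound : exists2 c, 0 < c &
  forall m, 0 < m -> (4 * (trunc_log 2 m).+1) ^ 18 <= c * m.
Proof.
exists (72 ^ 18); first by rewrite expn_gt0.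
move=> m m_gt0; set j := trunc_log 2 m; set q := j %/ 18.
have jm : 2 ^ j <= m by apply: trunc_logP.
have jq : j.+1 <= 18 * q.+1 by rewrite mulnC ltn_ceil.
have q2 : q.+1 <= 2 ^ q by apply: ltn_expl.
have Lq : 4 * j.+1 <= 72 * 2 ^ q by move: jq q2; clear; lia.
apply: leq_trans (_ : (72 * 2 ^ q) ^ 18 <= _); first by rewrite leq_exp2r.
rewrite expnMn leq_pmul2l ?expn_gt0 //; apply: leq_trans jm.
by rewrite -expnM leq_exp2l // leq_trunc_div.
Qed.

Variable R : realFieldType.

Lemma card_bigcup_le (I T : finType) (F : I -> {set T}) (c : I -> R) :
  (forall i, (#|F i|%:R <= c i)%R) -> (#|\bigcup_i F i|%:R <= \sum_i c i)%R.
Proof.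
move=> Fc; apply: (big_rec2 (fun (A : {set T}) (x : R) => #|A|%:R <= x)%R)
  => [|i A x _ Ax].
  by rewrite cards0.
by apply: le_trans (lerD (Fc i) Ax); rewrite -natrD ler_nat leq_card_setU.
Qed.

(* The term [i = 0] is [0^-1 = 0]. *)
Lemma harmonic_le k n : n <= 2 ^ k -> (\sum_(i < n) (i%:R^-1 : R) <= k%:R)%R.
Proof.
move=> nk; apply: (@le_trans _ _ (\sum_(i < 2 ^ k) (i%:R^-1 : R))%R).
  rewrite -!(big_mkord predT (fun i => i%:R^-1 : R)%R).
  rewrite [leRHS](big_cat_nat (leq0n n)) //= lerDl.
  by apply: sumr_ge0 => i _; rewrite invr_ge0 ler0n.
elim: k {n nk} => [|k IHk]; first by rewrite big_ord1 invr0.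
rewrite -!(big_mkord predT (fun i => i%:R^-1 : R)%R) in IHk *.
rewrite (big_cat_nat (leq0n (2 ^ k))) /= ?leq_exp2l // -natr1 lerD //.
(* Each dyadic block contributes at most [1]. *)
apply: (@le_trans _ _ (\sum_(2 ^ k <= i < 2 ^ k.+1) ((2 ^ k)%:R^-1 : R))%R).
  apply: ler_sum_nat => i /andP[ki _].
  have k_gt0 : 0 < 2 ^ k by rewrite expn_gt0.
  by rewrite lef_pV2 ?posrE ?ltr0n ?ler_nat // (leq_trans k_gt0).
rewrite sumr_const_nat expnS mul2n -addnn addnK -[(_ *+ _)%R]mulr_natr mulVf //.
by rewrite pnatr_eq0 -lt0n expn_gt0.
Qed.

Variables (m L : nat).
Local Notation T := ('I_m * 'I_m)%type.
Local Notation N := ((m ^ 2)`!).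

(** With the numerical condition inside, the set is empty for bad parameters, and unions can run
    over all quadruples. *)
Definition triple_set (a b a' b' : nat) : {set {perm T}} :=
  [set s | good_triple m L a b a' b' &&
           has_cycles [:: lcmn a b; lcmn a b'; lcmn a' b] s].

Definition pair_set (b b' : nat) : {set {perm T}} :=
  [set s | good_pair m L b b' && has_cycles [:: lcmn m b; lcmn m b'] s].

(** With [P] the product of the three lcms, [m ^ 4 a' b' <= (a L) ^ 2 (b L) ^ 2 a' b' = L ^ 4 (a b)
    (a b') (a' b) <= L ^ 7 P]. *)
Lemma card_triple_set a b a' b' :
  #|triple_set a b a' b'| * (m ^ 4 * (a' * b')) <= L ^ 7 * N.
Proof.
have [/and5P[_ _ ma mb /and3P[ab ab' a'b]]|/negPf ngood] :=
  boolP (good_triple m L a b a' b'); last first.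
  rewrite (_ : triple_set _ _ _ _ = set0) ?cards0 //.
  by apply/setP=> s; rewrite !inE ngood.
have := card_has_cycles T [:: lcmn a b; lcmn a b'; lcmn a' b].
rewrite card_prod card_ord mulnn !big_cons big_nil muln1; set P := lcmn _ _ * _ => cP.
apply: (@leq_trans (#|triple_set a b a' b'| * (L ^ 7 * P))).
  rewrite leq_mul2l; apply/orP; right.
  apply: (@leq_trans ((a * L) * ((a * L) * ((b * L) * (b * L))) * (a' * b'))).
    by rewrite leq_mul2r -[m ^ 4]/(m * (m * (m * m))) !leq_mul ?orbT.
  have := leq_mul (leqnn (L ^ 4)) (leq_mul ab (leq_mul ab' a'b)).
  rewrite /P; set x := lcmn a b; set y := lcmn a b'; set z := lcmn a' b.
  by congr (_ <= _); ring.
rewrite mulnCA leq_mul2l; apply/orP; right; apply: leq_trans cP.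
rewrite leq_mul2r; apply/orP; right; apply/subset_leq_card/subsetP=> s.
by rewrite !inE => /andP[].
Qed.

(** Here [m ^ 3 b' <= (b L) m ^ 2 b' = L (m b) (m b') <= L ^ 3 P]. *)
Lemma card_pair_set b b' : #|pair_set b b'| * (m ^ 3 * b') <= L ^ 3 * N.
Proof.
have [/and4P[_ mb mlb mlb']|/negPf ngood] := boolP (good_pair m L b b'); last first.
  rewrite (_ : pair_set _ _ = set0) ?cards0 //.
  by apply/setP=> s; rewrite !inE ngood.
have := card_has_cycles T [:: lcmn m b; lcmn m b'].
rewrite card_prod card_ord mulnn !big_cons big_nil muln1; set P := lcmn _ _ * _ => cP.
apply: (@leq_trans (#|pair_set b b'| * (L ^ 3 * P))).
  rewrite leq_mul2l; apply/orP; right.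
  apply: (@leq_trans ((b * L) * (m * m) * b')).
    by rewrite leq_mul2r -[m ^ 3]/(m * (m * m)) !leq_mul ?orbT.
  have := leq_mul (leqnn L) (leq_mul mlb mlb').
  rewrite /P; set x := lcmn m b; set y := lcmn m b'.
  by congr (_ <= _); ring.
rewrite mulnCA leq_mul2l; apply/orP; right; apply: leq_trans cP.
rewrite leq_mul2r; apply/orP; right; apply/subset_leq_card/subsetP=> s.
by rewrite !inE => /andP[].
Qed.

Definition many_cycles : {set {perm T}} := [set s | L < #|porbits s|].

Lemma class_support_wreath2_sub : 2 * L < m ->
  class_support (wreath2 m) [set: {perm T}] \subset
    many_cycles :|: \bigcup_(a < m.+1) \bigcup_(b < m.+1) \bigcup_(a' < m.+1)
                    \bigcup_(b' < m.+1) triple_set a b a' b'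
                :|: \bigcup_(b < m.+1) \bigcup_(b' < m.+1) pair_set b b'.
Proof.
move=> ltLm; apply/subsetP=> _ /imset2P[_ g /imsetP[[[s t] e] _ ->] _ ->] /=.
have [leL|ltL] := leqP #|porbits (coord_perm s t * swap_perm m ^+ e)%g| L; last first.
  by rewrite !inE card_porbits_conj ltL.
case: e leL => [|/=].
  (* A swapping element has at least [m / 2 > L] cycles. *)
  rewrite expg1 => leL; have := swap_coord_porbits s t.
  by rewrite leqNgt (leq_ltn_trans _ ltLm) // leq_mul2l leL.
rewrite expg0 mulg1 => leL.
have Lm : L < m by apply: leq_ltn_trans ltLm; rewrite leq_pmull.
have [[a [b [a' [b' [good cyc]]]]]|[b [b' [good cyc]]]] := coord_perm_cycles Lm leL.
  rewrite !in_setU; apply/orP; left; apply/orP; right.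
  apply/bigcupP; exists a => //; apply/bigcupP; exists b => //.
  apply/bigcupP; exists a' => //; apply/bigcupP; exists b' => //.
  by rewrite inE good has_cycles_conj.
rewrite !in_setU; apply/orP; right.
apply/bigcupP; exists b => //; apply/bigcupP; exists b' => //.
by rewrite inE good has_cycles_conj.
Qed.

Local Open Scope ring_scope.

(** In the union bound, [a] and [b] contribute [m.+1 ^ 2 <= 4 m ^ 2], while [a'] and [b'] contribute
    the square of a harmonic sum, at most [L ^ 2]. *)
Lemma card_triple_sets : (0 < m)%N -> (m < 2 ^ L)%N ->
  #|\bigcup_(a < m.+1) \bigcup_(b < m.+1) \bigcup_(a' < m.+1)
      \bigcup_(b' < m.+1) triple_set a b a' b'|%:R
  <= 4 * L%:R ^+ 9 / m%:R ^+ 2 * N%:R :> R.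
Proof.
move=> m_gt0 mL; pose K : R := L%:R ^+ 7 * N%:R / m%:R ^+ 4.
have m_gt0R : 0 < m%:R :> R by rewrite ltr0n.
have K_ge0 : 0 <= K by rewrite /K !mulr_ge0 ?exprn_ge0 ?invr_ge0 ?exprn_ge0.
pose H : R := \sum_(i < m.+1) i%:R^-1.
have HL : H <= L%:R by apply: harmonic_le.
have H_ge0 : 0 <= H by apply: sumr_ge0 => i _; rewrite invr_ge0.
have bound (a b a' b' : 'I_m.+1) :
    #|triple_set a b a' b'|%:R <= K * a'%:R^-1 * b'%:R^-1.
  (* For [a' = 0] or [b' = 0] the right-hand side is [0], as [0^-1 = 0], but then the set is
     empty. *)
  have [ngood|good] := eqVneq (triple_set a b a' b') set0.
    by rewrite ngood cards0 mulr0n; do ?[apply: mulr_ge0 => //]; rewrite invr_ge0 ler0n.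
  have [a'_gt0 b'_gt0] : (0 < a')%N /\ (0 < b')%N.
    by have /set0Pn[s] := good; rewrite inE => /andP[/and5P[-> ->]].
  have := card_triple_set a b a' b'; rewrite -(ler_nat R) !natrM.
  rewrite /K !ler_pdivlMr ?exprn_gt0 ?ltr0n //.
  move: (N%:R : R) (#|_|%:R : R) (m%:R : R) (L%:R : R) => M x y z.
  by congr (is_true (_ <= _)); ring.
apply: (@le_trans _ _ (\sum_(a < m.+1) \sum_(b < m.+1) \sum_(a' < m.+1)
                      \sum_(b' < m.+1) K * a'%:R^-1 * b'%:R^-1)).
  by do 4 (apply: card_bigcup_le => ?).
have -> : \sum_(a < m.+1) \sum_(b < m.+1) \sum_(a' < m.+1)
          \sum_(b' < m.+1) K * a'%:R^-1 * b'%:R^-1 = m.+1%:R ^+ 2 * (K * H ^+ 2).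
  under eq_bigr do under eq_bigr do under eq_bigr do rewrite -mulr_sumr.
  under eq_bigr do under eq_bigr do rewrite -mulr_suml -mulr_sumr.
  rewrite !sumr_const card_ord -/H -mulrnA -[LHS]mulr_natl natrM.
  by move: (m.+1%:R : R) K H {K_ge0 HL H_ge0 bound} => x y z; ring.
have m1 : m.+1%:R <= 2 * m%:R :> R.
  by rewrite -natrM ler_nat mul2n -addnn -addn1 leq_add2l.
apply: (@le_trans _ _ ((2 * m%:R) ^+ 2 * (K * L%:R ^+ 2))).
  apply: ler_pM.
  - by rewrite exprn_ge0.
  - by apply: mulr_ge0 => //; rewrite exprn_ge0.
  - by rewrite lerXn2r ?nnegrE ?mulr_ge0 ?ler0n.
  - by apply: ler_wpM2l => //; rewrite lerXn2r ?nnegrE ?ler0n.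
rewrite /K; move: (N%:R : R) m%:R m_gt0R (L%:R : R) => M x x_gt0 y.
by rewrite le_eqVlt; apply/orP; left; apply/eqP; field; rewrite gt_eqF.
Qed.

Lemma card_pair_sets : (0 < m)%N -> (m < 2 ^ L)%N ->
  #|\bigcup_(b < m.+1) \bigcup_(b' < m.+1) pair_set b b'|%:R
  <= 2 * L%:R ^+ 4 / m%:R ^+ 2 * N%:R :> R.
Proof.
move=> m_gt0 mL; pose K : R := L%:R ^+ 3 * N%:R / m%:R ^+ 3.
have m_gt0R : 0 < m%:R :> R by rewrite ltr0n.
have K_ge0 : 0 <= K by rewrite /K !mulr_ge0 ?exprn_ge0 ?invr_ge0 ?exprn_ge0.
pose H : R := \sum_(i < m.+1) i%:R^-1.
have HL : H <= L%:R by apply: harmonic_le.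
have H_ge0 : 0 <= H by apply: sumr_ge0 => i _; rewrite invr_ge0.
have bound (b b' : 'I_m.+1) : #|pair_set b b'|%:R <= K * b'%:R^-1.
  have [ngood|good] := eqVneq (pair_set b b') set0.
    by rewrite ngood cards0 mulr0n; do ?[apply: mulr_ge0 => //]; rewrite invr_ge0 ler0n.
  have b'_gt0 : (0 < b')%N by have /set0Pn[s] := good; rewrite inE => /andP[/and4P[->]].
  have := card_pair_set b b'; rewrite -(ler_nat R) !natrM.
  rewrite /K !ler_pdivlMr ?exprn_gt0 ?ltr0n //.
  move: (N%:R : R) (#|_|%:R : R) (m%:R : R) (L%:R : R) => M x y z.
  by congr (is_true (_ <= _)); ring.
apply: (@le_trans _ _ (\sum_(b < m.+1) \sum_(b' < m.+1) K * b'%:R^-1)).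
  by do 2 (apply: card_bigcup_le => ?).
have -> : \sum_(b < m.+1) \sum_(b' < m.+1) K * b'%:R^-1 = m.+1%:R * (K * H).
  under eq_bigr do rewrite -mulr_sumr.
  by rewrite sumr_const card_ord -[LHS]mulr_natl.
have m1 : m.+1%:R <= 2 * m%:R :> R.
  by rewrite -natrM ler_nat mul2n -addnn -addn1 leq_add2l.
apply: (@le_trans _ _ ((2 * m%:R) * (K * L%:R))).
  by apply: ler_pM => //; [apply: mulr_ge0 | apply: ler_wpM2l].
rewrite /K; move: (N%:R : R) m%:R m_gt0R (L%:R : R) => M x x_gt0 y.
by rewrite le_eqVlt; apply/orP; left; apply/eqP; field; rewrite gt_eqF.
Qed.

(** The proportion is at most [(m ^ 2 + 1) / 2 ^ L.+1], and [2 ^ L >= m ^ 4]. *)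
Lemma card_many_cycles : (0 < m)%N -> (m ^ 4 <= 2 ^ L)%N ->
  #|many_cycles|%:R <= 2 / m%:R ^+ 2 * N%:R :> R.
Proof.
move=> m_gt0 mL; have := card_many_porbits T L.+1.
rewrite card_prod card_ord mulnn => le.
have m_gt0R : 0 < m%:R :> R by rewrite ltr0n.
rewrite mulrAC ler_pdivlMr ?exprn_gt0 // -natrX -!natrM ler_nat.
rewrite -(leq_pmul2r (_ : 0 < m ^ 2)%N) ?expn_gt0 ?m_gt0 // -mulnA -expnD.
apply: leq_trans (leq_mul (leqnn _) mL) _; rewrite -/many_cycles in le.
apply: (@leq_trans (#|many_cycles| * 2 ^ L.+1)%N);
  first by rewrite leq_mul2l leq_exp2l // leqnSn orbT.
apply: leq_trans le _; rewrite mulnAC leq_mul2r; apply/orP; right.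
by rewrite -addn1 mul2n -addnn leq_add2l expn_gt0 m_gt0.
Qed.

Lemma card_class_support_wreath2 :
    (0 < L)%N -> (2 * L < m)%N -> (m < 2 ^ L)%N -> (m ^ 4 <= 2 ^ L)%N ->
  #|class_support (wreath2 m) [set: {perm T}]|%:R
  <= 8 * L%:R ^+ 9 / m%:R ^+ 2 * N%:R :> R.
Proof.
move=> L_gt0 ltLm m2L m4L; have m_gt0 : (0 < m)%N by apply: leq_ltn_trans ltLm.
have := subset_leq_card (class_support_wreath2_sub ltLm).
set A := many_cycles; set B := \bigcup_(a < _) _; set C := \bigcup_(b < _) _.
move=> leABC; apply: (@le_trans _ _ (#|A|%:R + #|B|%:R + #|C|%:R)).
  rewrite -!natrD ler_nat; apply: leq_trans leABC _.
  apply: leq_trans (leq_card_setU _ _) _; rewrite leq_add2r; exact: leq_card_setU.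
have := lerD (lerD (card_many_cycles m_gt0 m4L) (card_triple_sets m_gt0 m2L))
             (card_pair_sets m_gt0 m2L).
move/le_trans; apply; rewrite -!mulrDl ler_wpM2r // ler_wpM2r ?invr_ge0 ?exprn_ge0 //.
have L1 : 1 <= L%:R :> R by rewrite ler1n.
(* The constant is [8 = 2 + 4 + 2], all three powers of [L] being bounded by [L ^ 9]. *)
have : L%:R ^+ 4 <= L%:R ^+ 9 :> R by rewrite ler_weXn2l.
have : 1 <= L%:R ^+ 9 :> R by rewrite exprn_ege1.
lra.
Qed.

End Estimates.

(* Asymptotics of the proportion *)
From mathcomp Require Import all_classical all_reals all_analysis.

Import Order.TTheory GRing.Theory Num.Theory.
Import numFieldNormedType.Exports.
Local Open Scope classical_set_scope.
Local Open Scope ring_scope.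

Lemma conj_proportion_ge0 (R : realType) (gT : finGroupType) (W : {group gT}) :
  0 <= conj_proportion R W.
Proof. by rewrite /conj_proportion divr_ge0. Qed.

(** Squaring keeps all exponents integral: [L ^ 9] becomes [L ^ 18 <= c m], and [m ^ -3] is the
    square of [n ^ (- 3 / 4)]. *)
Lemma conj_proportion_wreath2_sqr_le (R : realType) : exists2 c, (0 < c)%N &
  forall m, (2 ^ 18 * c < m)%N ->
    conj_proportion R (wreath2 m) ^+ 2 <= 64 * c%:R / m%:R ^+ 3.
Proof.
have [c c_gt0 cP] := log_power_bound; exists c => // m ltcm.
have m_gt0 : (0 < m)%N by apply: leq_ltn_trans ltcm.
have m_gt0R : 0 < m%:R :> R by rewrite ltr0n.
set L := (4 * (trunc_log 2 m).+1)%N; have Lc : (L ^ 18 <= c * m)%N by apply: cP.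
have mj : (m < 2 ^ (trunc_log 2 m).+1)%N by apply: trunc_log_ltn.
(* This fixes the threshold: [(2 L) ^ 18 <= 2 ^ 18 c m < m ^ 2 <= m ^ 18]. *)
have Lm : (2 * L < m)%N.
  rewrite -(ltn_exp2r _ _ (isT : 0 < 18)%N) expnMn.
  apply: leq_ltn_trans (leq_mul (leqnn _) Lc) _; rewrite mulnA.
  apply: (@leq_trans (m * m)%N); first by rewrite ltn_mul2r m_gt0.
  by rewrite mulnn leq_pexp2l.
have mL : (m < 2 ^ L)%N by apply: leq_trans mj _; rewrite leq_exp2l // leq_pmull.
have m4L : (m ^ 4 <= 2 ^ L)%N by rewrite /L mulnC expnM leq_exp2r // ltnW.
have := card_class_support_wreath2 R (isT : (0 < L)%N) Lm mL m4L.
rewrite -mulnn -[in X in _ * X%:R](card_ord m) -card_prod -card_setT_perm.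
rewrite -ler_pdivrMr ?ltr0n ?cardG_gt0 // -/(conj_proportion R (wreath2 m)).
move: (conj_proportion_ge0 R (wreath2 m)).
set p := conj_proportion _ _ => p_ge0 ple.
apply: (@le_trans _ _ ((8 * L%:R ^+ 9 / m%:R ^+ 2) ^+ 2)).
  by rewrite lerXn2r // nnegrE // (le_trans p_ge0).
have LcR : L%:R ^+ 18 <= c%:R * m%:R :> R by rewrite -natrX -natrM ler_nat.
apply: (@le_trans _ _ (64 * (c%:R * m%:R) / m%:R ^+ 4)); last first.
  by rewrite le_eqVlt; apply/orP; left; apply/eqP; field; rewrite gt_eqF.
rewrite (_ : _ ^+ 2 = 64 * L%:R ^+ 18 / m%:R ^+ 4); last first.
  by move: (L%:R : R) => x; field; rewrite gt_eqF.
by rewrite ler_wpM2r ?invr_ge0 ?exprn_ge0 // ler_wpM2l.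
Qed.

Lemma powR_sqr_three_fourths (R : realType) (x : R) : 0 < x ->
  ((x ^+ 2) `^ (- (3 / 4))) ^+ 2 = (x ^+ 3)^-1.
Proof.
move=> x_gt0; rewrite -!powR_mulrn ?powR_ge0 ?ltW // -!powRrM -powRN.
by congr (_ `^ _); field.
Qed.

Theorem theorem7p5 (R : realType) (alpha : R) (halpha : 0 < alpha) :
  (fun m : nat => conj_proportion R (wreath2 m) : R^o) =O_\oo
  (fun m : nat => ((m ^ 2)%N%:R : R) `^ (- (3 / 4) + alpha) : R^o).
Proof.
have [c c_gt0 cP] := conj_proportion_wreath2_sqr_le R.
(* Squares are compared below, and [64 c <= (8 c) ^ 2] because [c >= 1]. *)
apply/eqO_exP; exists (8 * c%:R); first by rewrite mulr_gt0 ?ltr0n.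
exists (2 ^ 18 * c).+1 => // m /= ltcm.
have m_gt0 : (0 < m)%N by apply: leq_ltn_trans ltcm.
have m_gt0R : 0 < m%:R :> R by rewrite ltr0n.
rewrite !ger0_norm ?powR_ge0 ?conj_proportion_ge0 //.
pose y : R := (m%:R ^+ 2) `^ (- (3 / 4)).
(* As [m ^ 2 >= 1] and [alpha > 0], it suffices to bound by the power with exponent [- 3 / 4]. *)
apply: (@le_trans _ _ (8 * c%:R * y)); last first.
  rewrite ler_wpM2l ?mulr_ge0 // /y natrX ler_powR ?lerDl ?(ltW halpha) //.
  by rewrite exprn_ege1 // ler1n.
rewrite -(@ler_pXn2r _ 2) ?nnegrE ?conj_proportion_ge0 ?mulr_ge0 ?powR_ge0 //.
apply: le_trans (cP m ltcm) _; rewrite exprMn powR_sqr_three_fourths //.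
rewrite ler_wpM2r ?invr_ge0 ?exprn_ge0 //.
have c_ge1 : 1 <= c%:R :> R by rewrite ler1n.
by move: (c%:R : R) c_ge1 => x x_ge1; nra.
Qed.
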